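(* Let $n\in\mathbb{N}$. For $k=1,2,\dots,n-1$ the equality $$\mathrm{AL}_n^k=\mathcal{U}(\mathfrak{gl}_n)\cdot\det\nolimits_k(X)$$ holds, where $X=(x_{ij})_{1\le i,j\le n}$ is the matrix of coordinate functions on $\mathrm{Mat}_n(\mathbb{C})$.
   Context: $\mathfrak{S}_n$ is the symmetric group on $[n]=\{1,\dots,n\}$ and $\nu_n(w)$ is the number of cycles of $w\in\mathfrak{S}_n$ (fixed points included). For $k\in\mathbb{N}$ and $A=(a_{ij})_{1\le i,j\le n}$, $\det_k A:=\sum_{w\in\mathfrak{S}_n}(-\tfrac1k)^{n-\nu_n(w)}a_{w(1)1}\cdots a_{w(n)n}$. For $I\subset[n]$, $\mathfrak{S}_n(I)=\{w\in\mathfrak{S}_n : x\notin I\Rightarrow w(x)=x\}$. For $\tau\in\mathfrak{S}_n$, $A\cdot\tau=(a_{i\,\tau(j)})_{i,j}$. Let $\mathcal{P}(\mathrm{Mat}_n(\mathbb{C}))$ be the algebra of polynomial functions on $\mathrm{Mat}_n(\mathbb{C})$, with standard coordinates $x_{ij}$. The universal enveloping algebra $\mathcal{U}(\mathfrak{gl}_n)$ of $\mathfrak{gl}_n=\mathfrak{gl}_n(\mathbb{C})$ acts on it through $(E_{ij}\cdot f)(X)=\sum_{l=1}^n x_{il}\frac{\partial f}{\partial x_{jl}}(X)$, where $E_{ij}$ are the standard basis elements (matrix units) of $\mathfrak{gl}_n$. $\mathcal{U}(\mathfrak{gl}_n)\cdot\det_k(X)$ is the cyclic submodule generated by $\det_k(X)$.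 Let $\mathrm{ML}_n\subset\mathcal{P}(\mathrm{Mat}_n(\mathbb{C}))$ be the subspace of functions that are multilinear in the column vectors, i.e. $\mathrm{ML}_n=\bigoplus_{1\le i_1,\dots,i_n\le n}\mathbb{C}\cdot x_{i_11}\cdots x_{i_nn}$, and for $k\in\mathbb{N}$ let $$\mathrm{AL}_n^k=\Bigl\{f\in\mathrm{ML}_n : \sum_{\tau\in\mathfrak{S}_n(I)}f(X\cdot\tau)=0\ \text{ for every } I\subset[n]\text{ with }|I|>k\Bigr\}.$$ *)

(* Defs.v *)
From HB Require Import structures.
From mathcomp Require Import all_boot all_order all_algebra all_fingroup.
From mathcomp Require Import generic_quotient ring_quotient finmap.
From mathcomp Require Import boolp classical_sets reals complex.
From mathcomp Require Import mpoly.
From mathcomp Require monalg.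

Set Implicit Arguments.
Unset Strict Implicit.
Unset Printing Implicit Defensive.

Import GRing.Theory Quotient.
Local Open Scope ring_scope.
Local Open Scope quotient_scope.

(* The polynomial x_(i,j) on n x n matrices is the variable of index           *)
(* mxvec_index i j among the n * n variables. Over an infinite field           *)
(* {mpoly F[n * n]} is the algebra of polynomial functions on 'M[F]_n.         *)
Notation polmx F n := (mpoly.mpoly (n * n)%N F).

Section PolynomialFunctions.
Variables (F : fieldType) (n : nat).

Local Notation polmx := (polmx F n).

Definition coordmx : 'M[polmx]_n := \matrix_(i, j) 'X_(mxvec_index i j).

(* f(Y), for Y a matrix of polynomials *)
Definition substmx (f : polmx) (Y : 'M[polmx]_n) : polmx :=
  f \mPo [tuple mxvec Y 0 r | r < n * n].

Definition dcoord (i j : 'I_n) (f : polmx) : polmx :=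
  mderiv (mxvec_index i j) f.

Definition glE (i j : 'I_n) (f : polmx) : polmx :=
  \sum_(l < n) coordmx i l * dcoord j l f.

Lemma dcoordX i j k l : dcoord i j (coordmx k l) = ((k, l) == (i, j))%:R.
Proof.
rewrite /dcoord mxE mderivX mnm1E.
have -> : (mxvec_index k l == mxvec_index i j) = ((k, l) == (i, j)).
  by apply/eqP/eqP => [/cast_ord_inj/enum_rank_inj|[-> ->]].
case: eqP => [[-> ->]|_]; last by rewrite scale0r.
rewrite scale1r (_ : (_ - _)%MM = 0%MM) ?mpolyX0 //.
by apply/mnmP => r; rewrite mnmBE subnn mnm0E.
Qed.

Lemma dcoordC i j k l f : dcoord i j (dcoord k l f) = dcoord k l (dcoord i j f).
Proof. exact: mderiv_comm. Qed.

Fact glE_is_linear i j : linear (glE i j).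
Proof.
move=> c f g; rewrite /glE scaler_sumr -big_split; apply: eq_bigr => l _ /=.
by rewrite /dcoord linearP mulrDr scalerAr.
Qed.
HB.instance Definition _ i j :=
  GRing.isLinear.Build F polmx polmx _ (glE i j) (glE_is_linear i j).

Lemma glEM i j f g : glE i j (f * g) = glE i j f * g + f * glE i j g.
Proof.
rewrite /glE mulr_suml mulr_sumr -big_split; apply: eq_bigr => l _ /=.
rewrite /dcoord mderivM mulrDr; congr (_ + _); [exact: mulrA | exact: mulrCA].
Qed.

Lemma glEX i j k l : glE i j (coordmx k l) = (j == k)%:R * coordmx i l.
Proof.
rewrite /glE (bigD1 l) //= big1 ?addr0 => [|m ml].
  by rewrite dcoordX mulrC xpair_eqE eqxx andbT eq_sym.
by rewrite dcoordX xpair_eqE [l == m]eq_sym (negbTE ml) andbF mulr0.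
Qed.

Lemma glE_glE i j k l f : glE i j (glE k l f) = (j == k)%:R * glE i l f
  + \sum_(p < n) \sum_(q < n)
      coordmx k p * coordmx i q * dcoord j q (dcoord l p f).
Proof.
rewrite [in LHS]/(glE k l) linear_sum /glE mulr_sumr -big_split /=.
apply: eq_bigr => p _; rewrite -/(glE i j _) glEM glEX mulrA; congr (_ + _).
by rewrite /glE mulr_sumr; apply: eq_bigr => q _; rewrite mulrA.
Qed.

Lemma glE_bracket i j k l f :
  glE i j (glE k l f) - glE k l (glE i j f)
    = (j == k)%:R *: glE i l f - (l == i)%:R *: glE k j f.
Proof.
rewrite !glE_glE [X in (_ + X) - _]exchange_big /=.
rewrite [X in (_ + X) - _](_ : _ = \sum_(p < n) \sum_(q < n)
      coordmx i p * coordmx k q * dcoord l q (dcoord j p f)); last first.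
  apply: eq_bigr => p _; apply: eq_bigr => q _.
  by rewrite [coordmx k q * _]mulrC dcoordC.
rewrite opprD addrACA subrr addr0.
by rewrite !mulr_natl !scaler_nat.
Qed.

End PolynomialFunctions.


(* The tensor algebra of gl_n on the basis of matrix units: the free algebra   *)
(* on the letters (i, j).                                                      *)
Section TensorAlgebra.
Import monalg.
Variables (F : fieldType) (n : nat).

Definition tensgl := {malg F[{fmonom ('I_n * 'I_n)%type}]}.
HB.instance Definition _ := GRing.Lalgebra.on tensgl.

Definition tensE (i j : 'I_n) : tensgl := << fmu (i, j) >>.

Definition tensC (c : F) : tensgl := c%:MP.

Lemma tensCM c (t : tensgl) : tensC c * t = c *: t.
Proof. exact: mul_malgC. Qed.

Lemma tensMC c (t : tensgl) : t * tensC c = c *: t.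
Proof.
have -> : t * tensC c = fgmul t (tensC c) by exact: malgM_def.
rewrite fgmulgU.
transitivity (c *: \sum_(k <- msupp t) << mcoeff k t *g k >>); last by rewrite -monalgE.
rewrite scaler_sumr; apply: eq_bigr => k _.
by apply/malgP => m; rewrite mulm1 mcoeffZ !mcoeffU mulrC mulrnAr.
Qed.

Definition wordact (m : {fmonom ('I_n * 'I_n)%type}) (f : polmx F n) :=
  foldr (fun ij => glE ij.1 ij.2) f (m : seq ('I_n * 'I_n)).

Fact wordact_is_linear m : linear (wordact m).
Proof.
by move=> c f g; rewrite /wordact; elim: (m : seq _) => //= a s ->; rewrite linearP.
Qed.
HB.instance Definition _ m :=
  GRing.isLinear.Build F (polmx F n) (polmx F n) _ (wordact m)
    (wordact_is_linear m).

Definition tensact (t : tensgl) (f : polmx F n) : polmx F n :=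
  \sum_(m <- msupp t) mcoeff m t *: wordact m f.

Lemma tensactEw (d : {fset {fmonom ('I_n * 'I_n)%type}}) (t : tensgl) f :
  (msupp t `<=` d)%fset -> tensact t f = \sum_(m <- d) mcoeff m t *: wordact m f.
Proof.
move=> le; rewrite [LHS](big_fset_incl _ le) //= => m _ /mcoeff_outdom ->.
by rewrite scale0r.
Qed.

Lemma tensactU c m f : tensact << c *g m >> f = c *: wordact m f.
Proof. by rewrite (tensactEw _ msuppU_le) big_seq_fset1 mcoeffUU. Qed.

Fact tensact_linearl f : linear (tensact^~ f).
Proof.
move=> c s t; pose d := (msupp (c *: s + t) `|` (msupp s `|` msupp t))%fset.
rewrite !(@tensactEw d) /d ?fsubsetUl //.
- rewrite scaler_sumr -big_split; apply: eq_bigr => m _ /=.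
  by rewrite mcoeffD mcoeffZ scalerDl scalerA.
- by rewrite fsubsetU // fsubsetUr orbT.
- by rewrite fsubsetU // fsubsetUl orbT.
Qed.
Lemma tensact0l f : tensact 0 f = 0.
Proof. by rewrite /tensact msupp0 big_seq_fset0. Qed.

Lemma tensactDl s t f : tensact (s + t) f = tensact s f + tensact t f.
Proof. by have := tensact_linearl f 1 s t; rewrite !scale1r. Qed.

Lemma tensactZl c t f : tensact (c *: t) f = c *: tensact t f.
Proof. by have := tensact_linearl f c t 0; rewrite tensact0l !addr0. Qed.

Lemma tensactBl s t f : tensact (s - t) f = tensact s f - tensact t f.
Proof. by rewrite -!scaleN1r tensactDl tensactZl. Qed.

Lemma tensact_suml (I : Type) (r : seq I) (E : I -> tensgl) f :
  tensact (\sum_(i <- r) E i) f = \sum_(i <- r) tensact (E i) f.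
Proof.
by elim/big_rec2: _ => [|i x y _ <-]; rewrite ?tensact0l ?tensactDl //.
Qed.

Fact tensact_linearr t : linear (tensact t).
Proof.
move=> c f g; rewrite /tensact scaler_sumr -big_split; apply: eq_bigr => m _ /=.
by rewrite linearP scalerDr !scalerA mulrC.
Qed.
HB.instance Definition _ t :=
  GRing.isLinear.Build F (polmx F n) (polmx F n) _ (tensact t)
    (tensact_linearr t).

Lemma tensact1 f : tensact 1 f = f.
Proof. by rewrite tensactU scale1r /wordact fm1. Qed.

Lemma tensactM s t f : tensact (s * t) f = tensact s (tensact t f).
Proof.
rewrite malgME tensact_suml [RHS]/tensact.
apply: eq_bigr => m _; rewrite tensact_suml.
rewrite /(tensact t f) linear_sum scaler_sumr; apply: eq_bigr => m' _ /=.
rewrite tensactU linearZ /= scalerA; congr (_ *: _).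
by rewrite /wordact fmM foldr_cat.
Qed.

Lemma tensactE i j f : tensact (tensE i j) f = glE i j f.
Proof. by rewrite tensactU scale1r /wordact fmU. Qed.

End TensorAlgebra.

Section EnvelopingAlgebra.
Variables (F : fieldType) (n : nat).
Local Notation T := (tensgl F n).

(* E_ij (x) E_kl - E_kl (x) E_ij - [E_ij, E_kl] *)
Definition glrel (i j k l : 'I_n) : T :=
  tensE F i j * tensE F k l - tensE F k l * tensE F i j
  - ((j == k)%:R *: tensE F i l - (l == i)%:R *: tensE F k j).

Inductive glideal_spec : T -> Prop :=
| Glideal_rel i j k l : glideal_spec (glrel i j k l)
| Glideal0 : glideal_spec 0
| GlidealB s t : glideal_spec s -> glideal_spec t -> glideal_spec (s - t)
| GlidealMl s t : glideal_spec t -> glideal_spec (s * t)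
| GlidealMr s t : glideal_spec s -> glideal_spec (s * t).

Definition glideal : {pred T} := [pred t | `[< glideal_spec t >]].

Lemma glidealP t : reflect (glideal_spec t) (t \in glideal).
Proof. exact: asboolP. Qed.

Fact glideal_zmod_closed : zmod_closed glideal.
Proof.
split=> [|s t /glidealP Is /glidealP It]; apply/glidealP; first exact: Glideal0.
exact: GlidealB.
Qed.
HB.instance Definition _ := GRing.isZmodClosed.Build T glideal glideal_zmod_closed.

Lemma glidealMl s t : t \in glideal -> s * t \in glideal.
Proof. by move=> /glidealP It; apply/glidealP/GlidealMl. Qed.

Lemma glidealMr s t : s \in glideal -> s * t \in glideal.
Proof. by move=> /glidealP Is; apply/glidealP/GlidealMr. Qed.

Lemma tensact_comm (s t : T) f :
  tensact (s * t - t * s) f = tensact s (tensact t f) - tensact t (tensact s f).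
Proof. by apply: etrans (tensactBl _ _ _) _; congr (_ - _); apply: tensactM. Qed.

Lemma tensact_glrel i j k l f : tensact (glrel i j k l) f =
  glE i j (glE k l f) - glE k l (glE i j f)
  - ((j == k)%:R *: glE i l f - (l == i)%:R *: glE k j f).
Proof.
apply: etrans (tensactBl _ _ _) _; congr (_ - _).
  by apply: etrans (tensact_comm _ _ _) _; rewrite !tensactE.
apply: etrans (tensactBl _ _ _) _.
by congr (_ - _); apply: etrans (tensactZl _ _ _) _; rewrite tensactE.
Qed.

Lemma tensact_glideal t f : t \in glideal -> tensact t f = 0.
Proof.
move=> /glidealP It; elim: It f => {t} [i j k l||s t _ IHs _ IHt|s t _ IHt|s t _ IHs] f.
- rewrite tensact_glrel glE_bracket; exact: subrr.
- exact: tensact0l.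
- by rewrite tensactBl IHs IHt subrr.
- by rewrite tensactM IHt linear0.
- by rewrite tensactM IHs.
Qed.

Definition Ugl := {quot glideal}.
HB.instance Definition _ := GRing.Zmodule.on Ugl.
HB.instance Definition _ := EqQuotient.on Ugl.

Definition Ugl_one : Ugl := \pi_Ugl 1.
Definition Ugl_mul : Ugl -> Ugl -> Ugl := lift_op2 Ugl *%R.
Definition Ugl_scale (c : F) : Ugl -> Ugl := lift_op1 Ugl ( *:%R c).

Lemma Ugl_eqP (s t : T) : (\pi_Ugl s = \pi_Ugl t) <-> s - t \in glideal.
Proof. by rewrite idealrBE; split=> [->|/eqP]. Qed.

Lemma repr_pi (s : T) : repr (\pi_Ugl s) - s \in glideal.
Proof. by apply/Ugl_eqP; rewrite reprK. Qed.

Lemma Ugl_piM s t : \pi_Ugl (s * t) = Ugl_mul (\pi_Ugl s) (\pi_Ugl t).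
Proof.
rewrite /Ugl_mul -lock; apply/esym/Ugl_eqP; set s' := repr _; set t' := repr _.
have -> : s' * t' - s * t = (s' - s) * t' + s * (t' - t).
  by rewrite mulrBl mulrBr addrA subrK.
by rewrite rpredD //; [apply: glidealMr | apply: glidealMl]; apply: repr_pi.
Qed.

Lemma Ugl_piZ c s : \pi_Ugl (c *: s) = Ugl_scale c (\pi_Ugl s).
Proof.
rewrite /Ugl_scale -lock; apply/esym/Ugl_eqP; rewrite -scalerBr -tensCM.
by apply: glidealMl; apply: repr_pi.
Qed.

Lemma Ugl_piD s t : \pi_Ugl (s + t) = \pi_Ugl s + \pi_Ugl t.
Proof. exact: pi_add. Qed.

Lemma Ugl_pi0 : \pi_Ugl 0 = 0.
Proof. by apply: (addrI (\pi_Ugl 0)); rewrite -Ugl_piD !addr0. Qed.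

Lemma Ugl_piB s t : \pi_Ugl (s - t) = \pi_Ugl s - \pi_Ugl t.
Proof. by apply: (addIr (\pi_Ugl t)); rewrite -Ugl_piD !subrK. Qed.

Fact Ugl_mulA : associative Ugl_mul.
Proof.
move=> u v w; rewrite -[u]reprK -[v]reprK -[w]reprK.
by rewrite -!Ugl_piM mulrA.
Qed.

Fact Ugl_mul1l : left_id Ugl_one Ugl_mul.
Proof. by move=> u; rewrite -[u]reprK -Ugl_piM mul1r. Qed.

Fact Ugl_mul1r : right_id Ugl_one Ugl_mul.
Proof. by move=> u; rewrite -[u]reprK -Ugl_piM mulr1. Qed.

Fact Ugl_mulDl : left_distributive Ugl_mul +%R.
Proof.
move=> u v w; rewrite -[u]reprK -[v]reprK -[w]reprK.
by rewrite -Ugl_piD -!Ugl_piM -Ugl_piD mulrDl.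
Qed.

Fact Ugl_mulDr : right_distributive Ugl_mul +%R.
Proof.
move=> u v w; rewrite -[u]reprK -[v]reprK -[w]reprK.
by rewrite -Ugl_piD -!Ugl_piM -Ugl_piD mulrDr.
Qed.

(* 1 acts as the identity on polynomial functions, elements of the ideal as 0 *)
Fact Ugl_one_neq0 : Ugl_one != 0.
Proof.
apply/eqP; rewrite /Ugl_one -Ugl_pi0 => /Ugl_eqP.
rewrite subr0 => /(@tensact_glideal _ 1) /eqP.
by rewrite tensact1 oner_eq0.
Qed.

HB.instance Definition _ := GRing.Zmodule_isNzRing.Build Ugl
  Ugl_mulA Ugl_mul1l Ugl_mul1r Ugl_mulDl Ugl_mulDr Ugl_one_neq0.

Fact Ugl_scaleA c d u : Ugl_scale c (Ugl_scale d u) = Ugl_scale (c * d) u.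
Proof. by rewrite -[u]reprK -!Ugl_piZ scalerA. Qed.

Fact Ugl_scale1 : left_id 1 Ugl_scale.
Proof. by move=> u; rewrite -[u]reprK -Ugl_piZ scale1r. Qed.

Fact Ugl_scaleDr : right_distributive Ugl_scale +%R.
Proof.
move=> c u v; rewrite -[u]reprK -[v]reprK.
by rewrite -Ugl_piD -!Ugl_piZ -Ugl_piD scalerDr.
Qed.

Fact Ugl_scaleDl u : {morph Ugl_scale^~ u : c d / c + d}.
Proof. by move=> c d; rewrite -[u]reprK -!Ugl_piZ -Ugl_piD scalerDl. Qed.

HB.instance Definition _ := GRing.Zmodule_isLmodule.Build F Ugl
  Ugl_scaleA Ugl_scale1 Ugl_scaleDr Ugl_scaleDl.

Fact Ugl_scaleAl c (u v : Ugl) : c *: (u * v) = c *: u * v.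
Proof.
rewrite -[LHS]/(Ugl_scale c (Ugl_mul u v)) -[RHS]/(Ugl_mul (Ugl_scale c u) v).
by rewrite -[u]reprK -[v]reprK -Ugl_piZ -!Ugl_piM -Ugl_piZ scalerAl.
Qed.
HB.instance Definition _ := GRing.Lmodule_isLalgebra.Build F Ugl Ugl_scaleAl.

Fact Ugl_scaleAr c (u v : Ugl) : c *: (u * v) = u * (c *: v).
Proof.
rewrite -[LHS]/(Ugl_scale c (Ugl_mul u v)) -[RHS]/(Ugl_mul u (Ugl_scale c v)).
rewrite -[u]reprK -[v]reprK -Ugl_piZ -!Ugl_piM -Ugl_piZ -!tensMC.
by rewrite mulrA.
Qed.
HB.instance Definition _ := GRing.Lalgebra_isAlgebra.Build F Ugl Ugl_scaleAr.

Definition UglE (i j : 'I_n) : Ugl := \pi_Ugl (tensE F i j).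

Lemma UglE_bracket i j k l :
  UglE i j * UglE k l - UglE k l * UglE i j
    = (j == k)%:R *: UglE i l - (l == i)%:R *: UglE k j.
Proof.
rewrite -[LHS]/(Ugl_mul (UglE i j) (UglE k l) - Ugl_mul (UglE k l) (UglE i j)).
rewrite -[RHS]/(Ugl_scale _ (UglE i l) - Ugl_scale _ (UglE k j)).
rewrite -!Ugl_piM -!Ugl_piZ -!Ugl_piB; apply/Ugl_eqP.
exact/glidealP/Glideal_rel.
Qed.

Definition Uglact (u : Ugl) (f : polmx F n) : polmx F n := tensact (repr u) f.

Lemma Uglact_pi t f : Uglact (\pi_Ugl t) f = tensact t f.
Proof.
apply/eqP; rewrite -subr_eq0 -tensactBl.
by rewrite tensact_glideal ?repr_pi.
Qed.

Lemma Uglact_linearl f : linear (Uglact^~ f).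
Proof.
move=> c u v; rewrite -[c *: u]/(Ugl_scale c u).
rewrite -[u in LHS]reprK -[v in LHS]reprK -Ugl_piZ -Ugl_piD Uglact_pi.
by apply: etrans (tensactDl _ _ _) _; congr (_ + _); apply: tensactZl.
Qed.

Lemma Uglact_linearr u : linear (Uglact u).
Proof. exact: tensact_linearr. Qed.

Lemma Uglact1 f : Uglact 1 f = f.
Proof. by apply: etrans (Uglact_pi 1 f) _; apply: tensact1. Qed.

Lemma UglactM u v f : Uglact (u * v) f = Uglact u (Uglact v f).
Proof.
rewrite -[u * v]/(Ugl_mul u v) -[u in LHS]reprK -[v in LHS]reprK -Ugl_piM.
by apply: etrans (Uglact_pi _ f) _; apply: tensactM.
Qed.

Lemma UglactE i j f : Uglact (UglE i j) f = glE i j f.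
Proof. by rewrite Uglact_pi tensactE. Qed.

Definition Ugl_cyclic (f : polmx F n) : set (polmx F n) :=
  [set Uglact u f | u in [set: Ugl]].

End EnvelopingAlgebra.

Section AlphaDeterminant.
Variables (F : fieldType) (n : nat).

Definition ncycles (w : 'S_n) : nat := #|porbits w|.

Definition detk (S : comAlgType F) (k : nat) (A : 'M[S]_n) : S :=
  \sum_(w : 'S_n) (- (k%:R)^-1 : F) ^+ (n - ncycles w)
     *: \prod_(j < n) A (w j) j.

Definition MLspace : set (polmx F n) :=
  [set f | exists c : {ffun 'I_n -> 'I_n} -> F,
     f = \sum_(h : {ffun 'I_n -> 'I_n})
           c h *: \prod_(j < n) coordmx F n (h j) j].

(* A . tau is col_perm tau A, and perm_on I tau says that tau fixes every      *)
(* point outside I.                                                            *)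
Definition ALspace (k : nat) : set (polmx F n) :=
  [set f | MLspace f /\
     forall I : {set 'I_n}, (k < #|I|)%N ->
       \sum_(tau : 'S_n | perm_on I tau)
          substmx f (col_perm tau (coordmx F n)) = 0].

End AlphaDeterminant.

(* Main.v *)
Require Import Defs.
From HB Require Import structures.
From mathcomp Require Import all_boot all_order all_algebra all_fingroup.
From mathcomp Require Import boolp classical_sets reals complex.
From mathcomp Require Import mpoly.
From mathcomp Require Import zify.

Set Implicit Arguments.
Unset Strict Implicit.
Unset Printing Implicit Defensive.

Import Order.TTheory GRing.Theory Num.Theory.
Local Open Scope ring_scope.

(** Multilinear polynomials are the functions on words h : [n] -> [n], the word
    h standing for the monomial prod_j x_(h(j), j); permuting the columns of X
    permutes the positions of the words.  Let A_c be the antisymmetriser over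
    the Young subgroup of the permutations that preserve a colouring
    c : [n] -> [k].  A permutation w preserves k^(number of cycles of w)
    colourings, and therefore
      k^n (-1/k)^(n - nu(w)) = sgn(w) #{c | w preserves c} :
    the operator Phi = sum_w (-1/k)^(n - nu(w)) w that defines det_k is, up to
    the factor k^n, the sum of all the A_c ([alpha_opE]).  Everything follows
    from this.

    - The image of Phi lies in AL_n^k: if |I| > k then two positions of I have
      the same colour, and their transposition is absorbed by A_c with the sign -1
      and by the symmetriser over I with the sign +1 ([symfree_antisym]).  As det_k(X) is the image under Phi
      of the word 12...n, and as AL_n^k is a gl_n-submodule, the cyclic submodule
      is contained in AL_n^k.

    - Conversely AL_n^k is contained in the image of Phi ([symfree_alpha]).
      Phi is symmetric, so it suffices to pair f in AL_n^k with g in the kernel of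
      Phi and find 0 ([fredholm]).  Each A_c is a positive multiple of an
      orthogonal projection, so such a g is killed by every A_c
      ([antisym_alpha_eq0]).  Modulo the images of the A_c, which are orthogonal
      to g, one can eliminate the lexicographically largest word h in the support
      of f ([symfree_dot]).  Indeed, either h has a weakly increasing subsequence
      of length > k, at the positions I; symmetrising over I gives words that are
      at least h, so that f(h) = 0.  Or h is a union of k strictly decreasing
      subsequences ([incr_or_decr]), the classes of a colouring c, and then A_c h is
      h up to signed smaller words, so that f(h) A_c h can be subtracted from f.

    - The image of Phi is spanned by the alpha-determinants D_h of the matrices
      with rows h(1), ..., h(n) of X ([mlpol_alpha_op]).  The matrix unit E_ij
      replaces a row j by the row i, in all possible ways, so every D_h can be
      obtained from D_id = det_k(X) ([reach_alphadet]): transpositions of rows are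
      E_ab E_ba - 1, and a repeated row arises from a row that occurs once. *)

(** * Words, their lexicographic order and monotone subsequences *)

Section Words.
Variables n m : nat.
Implicit Types (h : {ffun 'I_n -> 'I_m}) (s t : 'S_n) (I : {set 'I_n}).

Definition wperm h s : {ffun 'I_n -> 'I_m} := [ffun j => h (s j)].

Lemma wperm1 h : wperm h 1%g = h.
Proof. by apply/ffunP => j; rewrite ffunE perm1. Qed.

Lemma wpermM h s t : wperm (wperm h s) t = wperm h (t * s)%g.
Proof. by apply/ffunP => j; rewrite !ffunE permM. Qed.

Lemma wpermK s : cancel (wperm^~ s) (wperm^~ s^-1%g).
Proof. by move=> h; rewrite wpermM mulVg wperm1. Qed.

Lemma wpermVK s : cancel (wperm^~ s^-1%g) (wperm^~ s).
Proof. by move=> h; rewrite wpermM mulgV wperm1. Qed.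

Lemma sum_wperm (V : nmodType) (F : {ffun 'I_n -> 'I_m} -> V) s :
  \sum_h F (wperm h s) = \sum_h F h.
Proof. by rewrite [RHS](reindex_inj (can_inj (wpermK s))). Qed.

Lemma eq_wperm_inv h g s : (wperm h s == g) = (h == wperm g s^-1%g).
Proof. by apply/eqP/eqP => [<-|->]; rewrite ?wpermK ?wpermVK. Qed.

Definition lexlt h h' :=
  [exists p : 'I_n,
    (h p < h' p)%N && [forall q : 'I_n, (q < p)%N ==> (h q == h' q)]].

Lemma lexltP h h' :
  reflect (exists2 p : 'I_n, (h p < h' p)%N &
             forall q : 'I_n, (q < p)%N -> h q = h' q)
          (lexlt h h').
Proof.
apply: (iffP existsP) => [[p /andP[lt /forallP eqh]]|[p lt eqh]]; exists p => //.
  by move=> q qp; apply/eqP; have /implyP := eqh q; apply.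
by rewrite lt; apply/forallP => q; apply/implyP => /eqh ->.
Qed.

Lemma lexlt_irr h : lexlt h h = false.
Proof. by apply/lexltP => -[p]; rewrite ltnn. Qed.

Lemma lexlt_trans : transitive lexlt.
Proof.
move=> h2 h1 h3 /lexltP[p lt1 eq1] /lexltP[q lt2 eq2]; apply/lexltP.
case: (ltngtP p q) => [pq|qp|/val_inj pq].
- exists p => [|r rp]; first by rewrite -eq2.
  by rewrite eq1 // eq2 // (ltn_trans rp).
- exists q => [|r rq]; first by rewrite eq1.
  by rewrite eq1 ?eq2 // (ltn_trans rq).
- exists p => [|r rp]; first by rewrite (ltn_trans lt1) // pq.
  by rewrite eq1 // eq2 // -pq.
Qed.

(** Turns the comparison of words into a comparison of integers. *)
Definition lexrank h := #|[pred g | lexlt g h]|.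

Lemma lexrank_lt h h' : lexlt h h' -> (lexrank h < lexrank h')%N.
Proof.
move=> lt; apply/proper_card/properP; split.
  by apply/fintype.subsetP => g; rewrite !inE => /lexlt_trans; apply.
by exists h; rewrite !inE ?lexlt_irr.
Qed.

(** If u (s p) < u p, then the positions q of I with u q < u p, which all precede
    p, are permuted among themselves by s; but s also sends p there. *)
Lemma first_moved_le (u : 'I_n -> nat) I s p :
    p \in I -> {in I, forall q, s q \in I} ->
    {in I, forall q : 'I_n, (p <= q)%N -> (u p <= u q)%N} ->
    (forall q : 'I_n, (q < p)%N -> u (s q) = u q) ->
  (u p <= u (s p))%N.
Proof.
move=> pI sI incr fix_lt; rewrite leqNgt; apply/negP => lt_sp.
pose S := [set q in I | (u q < u p)%N].
have sS q : q \in S -> s q \in S.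
  rewrite !inE => /andP[qI qp]; rewrite sI //= fix_lt //.
  by rewrite ltnNge; apply/negP => /(incr _ qI); rewrite leqNgt qp.
have : s p \in S by rewrite inE sI.
have -> : S = s @: S.
  apply/esym/eqP; rewrite eqEcard card_imset ?leqnn ?andbT; last exact: perm_inj.
  by apply/fintype.subsetP => _ /imsetP[q qS ->]; exact: sS.
by rewrite mem_imset ?inE ?ltnn ?andbF //; exact: perm_inj.
Qed.

Lemma first_diff h h' : h != h' ->
  exists2 p : 'I_n, h p != h' p & forall q : 'I_n, (q < p)%N -> h q = h' q.
Proof.
move=> ne; have /existsP[p0 p0P] : [exists p, h p != h' p].
  apply: contraNT ne => /existsPn eqh; apply/eqP/ffunP => p.
  by apply/eqP; rewrite -[_ == _]negbK.
case: (@arg_minnP _ p0 [pred p | h p != h' p] (fun p => p)) => // p /= pP pmin.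
exists p => // q qp; apply/eqP; apply: contraLR qp => /pmin.
by rewrite -leqNgt.
Qed.

Definition incr_on h I :=
  [forall p : 'I_n in I, forall q : 'I_n in I, (p <= q)%N ==> (h p <= h q)%N].

Lemma incr_onP h I :
  reflect {in I &, forall p q : 'I_n, (p <= q)%N -> (h p <= h q)%N} (incr_on h I).
Proof.
apply: (iffP forall_inP) => [H p q pI qI|H p pI].
  by have /forall_inP/(_ q qI)/implyP := H p pI.
by apply/forall_inP => q qI; apply/implyP; exact: H.
Qed.

Lemma lexlt_incr h I s : incr_on h I -> perm_on I s ->
  wperm h s != h -> lexlt h (wperm h s).
Proof.
move=> /incr_onP incr sI /first_diff[p ne eq_lt]; apply/lexltP.
have pI : p \in I.
  by apply: contraR ne => pI; rewrite ffunE (out_perm sI).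
exists p => [|q /eq_lt //]; rewrite ltn_neqAle eq_sym ne /= ffunE.
apply: (@first_moved_le (fun q => h q) I) => // [q qI|q qI|q /eq_lt].
- by rewrite perm_closed.
- exact: incr.
- by rewrite ffunE => ->.
Qed.

Section Colourings.
Variable k : nat.
Implicit Type c : {ffun 'I_n -> 'I_k}.

Definition young c := [set s : 'S_n | [forall j, c (s j) == c j]].

Lemma youngP c s : reflect (forall j, c (s j) = c j) (s \in young c).
Proof. by rewrite inE; apply: (iffP forallP) => H j; apply/eqP. Qed.

Lemma young_group_set c : group_set (young c).
Proof.
apply/group_setP; split=> [|s t /youngP sc /youngP tc]; apply/youngP => j.
  by rewrite perm1.
by rewrite permM tc.
Qed.
Canonical young_group c := Group (young_group_set c).

Definition decr_on_classes h c :=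
  forall p q : 'I_n, c p = c q -> (p < q)%N -> (h q < h p)%N.

(** The counterpart of [lexlt_incr] for Young subgroups.  Here the word really
    changes, because it is injective on each class. *)
Lemma lexlt_decr h c s : decr_on_classes h c -> s \in young c -> s != 1%g ->
  lexlt (wperm h s) h.
Proof.
move=> decr /youngP sc s1.
have /first_diff[p ne eq_lt] : wperm h s != h.
  apply: contraNneq s1 => eqh; apply/eqP/permP => j; rewrite perm1; apply: val_inj.
  have hj : h (s j) = h j by move/ffunP/(_ j): eqh; rewrite ffunE.
  case: (ltngtP (s j) j) => // lt.
    by have := decr _ _ (sc j) lt; rewrite hj ltnn.
  by have := decr _ _ (esym (sc j)) lt; rewrite hj ltnn.
apply/lexltP; exists p => [|q /eq_lt //]; rewrite ltn_neqAle ne /= ffunE.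
(* Reversing the alphabet makes h increasing on the class of p. *)
have := @first_moved_le (fun q => m - h q)%N [set q | c q == c p] s p.
rewrite inE eqxx => /(_ isT) H.
have : (m - h p <= m - h (s p))%N.
  apply: H => [q|q|q /eq_lt].
  - by rewrite !inE sc.
  - rewrite inE => /eqP cq; rewrite leq_eqVlt => /predU1P[/val_inj->//|].
    by move/(decr _ _ (esym cq)) => lt; exact: leq_sub2l (ltnW lt).
  - by rewrite ffunE => ->.
by rewrite -(leq_sub2lE _ (ltnW (ltn_ord (h (s p))))).
Qed.

(** The colour of a position p is the maximal length of a weakly increasing
    subsequence that ends at p: if p < q have the same colour, then h q < h p, or
    else a longest subsequence ending at p could be prolonged by q. *)
Lemma incr_or_decr h :
  (exists2 I : {set 'I_n}, (k < #|I|)%N & incr_on h I) \/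
  (exists c, decr_on_classes h c).
Proof.
pose ends p := [pred I : {set 'I_n} |
  incr_on h I & (p \in I) && [forall q : 'I_n in I, q <= p]%N].
pose len p := \max_(I | ends p I) #|I|.
have endsP p : {I | ends p I & len p = #|I|}.
  apply: eq_bigmax_cond; apply/card_gt0P.
  exists [set p]; apply/and3P; split; [|exact: set11|].
    by apply/incr_onP => a b /set1P-> /set1P->.
  by apply/forall_inP => q /set1P ->.
have [p pk|lek] := pickP [pred p | (k < len p)%N].
  left; have [I /andP[incI _] eqI] := endsP p.
  by exists I => //; rewrite -eqI.
right.
have lenk p : ((len p).-1 < k)%N.
  have := lek p; rewrite /= ltnNge => /negbFE; apply: leq_trans.
  have [I /and3P[_ pI _] eqI] := endsP p.
  by rewrite eqI prednK // card_gt0; apply/set0Pn; exists p.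
exists [ffun p => Ordinal (lenk p)] => p q; rewrite !ffunE => -[eqc] pq.
rewrite ltnNge; apply/negP => hpq.
have [I /and3P[/incr_onP incI pI /forall_inP maxI] eqI] := endsP p.
have qI : q \notin I by apply: contraL pq => /maxI; rewrite -leqNgt.
have : (#|q |: I| <= len q)%N.
  apply: (@leq_bigmax_cond _ (ends q) (fun I => #|I|)).
  apply/and3P; split; [|exact: setU11|].
    apply/incr_onP => a b /setU1P[->|aI] /setU1P[->|bI] //.
    - by move=> qb; have := maxI b bI; lia.
    - by move=> _; apply: leq_trans (incI _ _ aI pI (maxI a aI)) hpq.
    - exact: incI.
  apply/forall_inP => a /setU1P[->//|/maxI ap]; lia.
rewrite cardsU1 qI -eqI => lenq.
have : (0 < #|I|)%N by rewrite card_gt0; apply/set0Pn; exists p.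
by rewrite -eqI; lia.
Qed.

End Colourings.
End Words.

(** * Antisymmetrisers of Young subgroups *)

Section Antisymmetrisers.
Variables (F : numFieldType) (n m k : nat).
Local Notation word := {ffun 'I_n -> 'I_m}.
Implicit Types (f g : word -> F) (h : word) (c : {ffun 'I_n -> 'I_k}).

Definition antisym c f h : F :=
  \sum_(s in young c) (-1) ^+ s * f (wperm h s).

(** The condition that defines AL_n^k, on coefficients; see [ALspaceE]. *)
Definition symfree f :=
  forall I : {set 'I_n}, (k < #|I|)%N ->
    forall h, \sum_(s : 'S_n | perm_on I s) f (wperm h s) = 0.

Lemma antisym_young c f h t : t \in young c ->
  antisym c f (wperm h t) = (-1) ^+ t * antisym c f h.
Proof.
move=> tc; rewrite /antisym [in RHS](reindex_inj (mulIg t)) mulr_sumr /=.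
apply: eq_big => [s|s _]; first by rewrite groupMr.
by rewrite wpermM odd_permM mulrA addbC signr_addb mulrA -signr_addb addbb mul1r.
Qed.

(** Among more than k positions two have the same colour; their transposition
    changes the sign of [antisym c f] and fixes the symmetriser over I. *)
Lemma symfree_antisym c f : symfree (antisym c f).
Proof.
move=> I ltkI h.
have [a [b [aI bI ab cab]]] : exists a b, [/\ a \in I, b \in I, a != b & c a = c b].
  have /dinjectivePn[a aI [b /andP[ba bI] cab]] : ~~ dinjectiveb c (mem I).
    apply: contraL ltkI => /dinjectiveP injc; rewrite -leqNgt -(card_in_imset injc).
    by rewrite -[X in (_ <= X)%N]card_ord max_card.
  by exists a, b; split; rewrite // eq_sym.
have tI : perm_on I (tperm a b).
  apply/fintype.subsetP => x; rewrite inE; case: tpermP => [->|->|] //.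
  by rewrite eqxx.
have tc : tperm a b \in young c.
  by apply/youngP => j; case: tpermP => [->|->|].
set S := LHS; have : S = - S.
  rewrite {1}/S (reindex_inj (mulgI (tperm a b))) /= -sumrN.
  apply: eq_big => [s|s _]; last first.
    by rewrite -wpermM antisym_young // odd_tperm ab mulN1r.
  apply/idP/idP => sI; last exact: perm_onM.
  by rewrite -(mulKg (tperm a b) s) tpermV perm_onM.
by move/eqP; rewrite -subr_eq0 opprK -mulr2n mulrn_eq0 => /eqP.
Qed.

Lemma antisym_dot c f g :
  \sum_h antisym c f h * g h = \sum_h f h * antisym c g h.
Proof.
under eq_bigr do rewrite mulr_suml.
under [RHS]eq_bigr do rewrite mulr_sumr.
rewrite exchange_big [RHS]exchange_big (reindex_inj invg_inj) /=.
apply: eq_big => [s|s _]; first by rewrite groupV.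
rewrite -(sum_wperm _ s); apply: eq_bigr => h _.
by rewrite wpermK odd_permV -mulrA mulrCA.
Qed.

Lemma antisym_idem c f h :
  antisym c (antisym c f) h = #|young c|%:R * antisym c f h.
Proof.
rewrite {1}/antisym (eq_bigr (fun=> antisym c f h)) => [|s sc].
  by rewrite sumr_const mulr_natl.
by rewrite antisym_young // mulrA -signr_addb addbb mul1r.
Qed.

Lemma symfreeB f g a : symfree f -> symfree g ->
  symfree (fun h => f h - a * g h).
Proof.
move=> Lf Lg I ltkI h.
by rewrite sumrB -mulr_sumr Lf // Lg // mulr0 subrr.
Qed.

(** Induction on a finite lower set D of words that contains the support of f;
    the largest word of D is eliminated at each step. *)
Lemma symfree_dot_lower f g (D : {set word}) :
    (forall h h', lexlt h h' -> h' \in D -> h \in D) ->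
    (forall h, h \notin D -> f h = 0) ->
    symfree f -> (forall c h, antisym c g h = 0) ->
  \sum_h f h * g h = 0.
Proof.
have [N] := ubnP #|D|; elim: N => // N IHN in f D * => leDN downD suppf symf antig.
have [D0|/set0Pn[h0 h0D]] := eqVneq D finset.set0.
  by rewrite big1 // => u _; rewrite suppf ?mul0r ?D0 ?inE.
have [h hD maxh] := arg_maxnP (@lexrank n m) h0D.
have gth u : lexlt h u -> u \notin D.
  by move=> /lexrank_lt; apply: contraTN => /maxh; rewrite -leqNgt.
have ltD'N : (#|D :\ h| < N)%N by move: leDN; rewrite (cardsD1 h D) (hD : h \in D).
have downD' u v : lexlt u v -> v \in D :\ h -> u \in D :\ h.
  move=> uv; rewrite !inE => /andP[_ vD]; rewrite (downD u v) // andbT.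
  apply: contraTneq (lexrank_lt uv) => ->.
  by rewrite -leqNgt; apply: maxh.
(* In both cases f is replaced by a function supported on D minus h. *)
have [[I ltkI incI]|[c decc]] := incr_or_decr k h.
  apply: (IHN f _ ltD'N downD') => // u; rewrite !inE negb_and negbK.
  case/orP => [/eqP->{u}|/suppf//].
  (* The terms that differ from f h are at words above h, outside D. *)
  have := symf I ltkI h; rewrite (bigID (fun s => wperm h s == h)) /=.
  rewrite [X in _ + X]big1 => [|s /andP[sI ne]]; last first.
    exact/suppf/gth/(lexlt_incr incI).
  rewrite (eq_bigr (fun=> f h)) => [|s /andP[_ /eqP->] //].
  rewrite sumr_const addr0 => /eqP; rewrite mulrn_eq0 => /orP[|/eqP//].
  rewrite -leqn0 leqNgt => /negP[]; apply/card_gt0P; exists 1%g.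
  by apply/andP; rewrite wperm1 eqxx perm_on1.
(* The function d is h itself, as a basis vector. *)
pose d u : F := (u == h)%:R.
have antid u : u \notin D :\ h -> antisym c d u = (u == h)%:R.
  move=> uD; rewrite /antisym (bigD1 1%g) ?group1 //= odd_perm1 mul1r wperm1.
  rewrite big1 ?addr0 // => s /andP[sc s1]; rewrite /d.
  case: eqP => [eqh|_]; last by rewrite mulr0.
  case/negP: uD; rewrite -(wpermK s u) eqh.
  have lth : lexlt (wperm h s^-1) h.
    by apply: lexlt_decr decc _ _; rewrite ?groupV ?invg_eq1.
  rewrite !inE (downD _ h) // andbT.
  by apply: contraTneq lth => ->; rewrite lexlt_irr.
have -> : \sum_u f u * g u = \sum_u (f u - f h * antisym c d u) * g u.
  under [RHS]eq_bigr do rewrite mulrBl -mulrA.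
  rewrite sumrB -mulr_sumr antisym_dot [X in _ * X]big1 ?mulr0 ?subr0 // => u _.
  by rewrite antig mulr0.
apply: (IHN _ _ ltD'N downD') => // [u uD|]; last first.
  exact/symfreeB/symfree_antisym.
rewrite antid //; move: uD; rewrite !inE negb_and negbK.
have [->|_ /= /suppf->] := eqVneq u h; first by rewrite mulr1 subrr.
by rewrite mulr0 subrr.
Qed.

(** The functions with [symfree k f] are spanned by the images of the
    antisymmetrisers, in the form of an orthogonality statement. *)
Lemma symfree_dot f g :
  symfree f -> (forall c h, antisym c g h = 0) -> \sum_h f h * g h = 0.
Proof.
by apply: (@symfree_dot_lower f g [set: word]) => h; rewrite ?inE.
Qed.

End Antisymmetrisers.

(** * The alpha-operator and its image *)

(** The row space of a matrix is the orthogonal of its right kernel. *)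
Lemma fredholm (F : fieldType) (T : finType) (K : T -> T -> F) (f : T -> F) :
    (forall v, (forall x, \sum_y K x y * v y = 0) -> \sum_x f x * v x = 0) ->
  exists u, forall y, f y = \sum_x u x * K x y.
Proof.
move=> orth; pose N := #|T|.
pose M : 'M[F]_N := \matrix_(i, j) K (enum_val i) (enum_val j).
pose r : 'rV[F]_N := \row_j f (enum_val j).
have : (r <= M)%MS.
  rewrite submxE; apply/eqP/rowP => j; rewrite !mxE.
  rewrite -[RHS](orth (fun x => cokermx M (enum_rank x) j)) => [|x].
    rewrite [RHS](reindex_onto enum_val enum_rank) => [|? _] /=; last first.
      exact: enum_rankK.
    apply: eq_big => [i|i _]; first by rewrite enum_valK eqxx.
    by rewrite mxE enum_valK.
  have /matrixP/(_ (enum_rank x) j) := mulmx_coker M; rewrite !mxE => MC0.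
  rewrite -[RHS]MC0.
  rewrite (reindex_onto enum_val enum_rank) => [|? _] /=; last exact: enum_rankK.
  apply: eq_big => [i|i _]; first by rewrite enum_valK eqxx.
  by rewrite !mxE enum_valK enum_rankK.
case/submxP => u ru; exists (fun x => u 0 (enum_rank x)) => y.
have /rowP/(_ (enum_rank y)) := ru; rewrite !mxE enum_rankK => ->.
rewrite [RHS](reindex_onto enum_val enum_rank) => [|? _] /=; last exact: enum_rankK.
apply: eq_big => [i|i _]; first by rewrite enum_valK eqxx.
by rewrite !mxE enum_valK enum_rankK.
Qed.

Section AlphaOperator.
Variables (n k : nat).
Implicit Types s : 'S_n.

(** The invariant colourings are the functions on the set of cycles. *)
Lemma card_colourings_fixed s :
  #|[set c : {ffun 'I_n -> 'I_k} | s \in young c]| = (k ^ ncycles s)%N.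
Proof.
pose orb j : {B | B \in porbits s} := exist _ (porbit s j) (imset_f _ isT).
pose col (g : {ffun {B | B \in porbits s} -> 'I_k}) := [ffun j => g (orb j)].
have orb_onto B : exists j, orb j = B.
  by case: B => B BP; have /imsetP[j _ eqB] := BP; exists j; apply: val_inj.
have col_inj : injective col.
  move=> g1 g2 /ffunP eqg; apply/ffunP => B; have [j <-] := orb_onto B.
  by have := eqg j; rewrite !ffunE.
have := card_imset predT col_inj; rewrite card_ffun card_ord card_sig => <-.
congr #|pred_of_set _|; apply/setP => c; rewrite inE; apply/youngP/imsetP.
  move=> sc; have cE j i : (s ^+ i)%g j \in [pred q | c q == c j].
    elim: i => [|i IHi]; first by rewrite expg0 perm1 inE.
    by rewrite expgSr permM inE sc.
  have cP j j' : porbit s j = porbit s j' -> c j = c j'.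
    move=> eqj; have : j \in porbit s j' by rewrite -eqj porbit_id.
    by case/porbitP => i ->; have := cE j' i; rewrite inE => /eqP.
  have [rep repP] := fin_all_exists orb_onto.
  exists [ffun B => c (rep B)] => //; apply/ffunP => j; rewrite !ffunE.
  by apply: cP; have := repP (orb j) => /(congr1 val).
case=> g _ -> j; rewrite !ffunE; congr (g _); apply: val_inj => /=.
by apply/eqP; rewrite eq_porbit_mem -{1}[s]expg1 mem_porbit.
Qed.

Section Field.
Variable F : numFieldType.

(** The coefficient of s in the alpha-determinant for alpha = -1/k. *)
Definition alphaw s : F := (- k%:R^-1) ^+ (n - ncycles s).

Lemma alphawE s : (0 < k)%N ->
  k%:R ^+ n * alphaw s
    = (-1) ^+ s * #|[set c : {ffun 'I_n -> 'I_k} | s \in young c]|%:R.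
Proof.
move=> k0; rewrite card_colourings_fixed natrX /alphaw.
have le : (ncycles s <= n)%N.
  by rewrite -[X in (_ <= X)%N]card_ord; apply: leq_imset_card.
have kn0 : k%:R != 0 :> F by rewrite pnatr_eq0 -lt0n.
have -> : (-1) ^+ s = (-1) ^+ (n - ncycles s) :> F.
  by rewrite -[RHS]signr_odd oddB // /odd_perm card_ord.
rewrite (exprNn k%:R^-1) exprVn mulrCA; congr (_ * _).
by rewrite -{1}(subnKC le) exprD mulfK // expf_neq0.
Qed.

Variable m : nat.
Implicit Types (f : {ffun 'I_n -> 'I_m} -> F) (h : {ffun 'I_n -> 'I_m}).

Definition alpha_op f h : F := \sum_s alphaw s * f (wperm h s).

(** The decomposition into antisymmetrisers, obtained by counting in two ways the
    pairs of a permutation and a colouring that it preserves. *)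
Lemma alpha_opE f h : (0 < k)%N ->
  k%:R ^+ n * alpha_op f h = \sum_(c : {ffun 'I_n -> 'I_k}) antisym c f h.
Proof.
move=> k0; rewrite /alpha_op mulr_sumr [RHS](exchange_big_dep predT) //=.
apply: eq_bigr => s _; rewrite mulrA alphawE // sumr_const mulrAC mulr_natr.
by congr (_ *+ _); apply: eq_card => c; rewrite inE.
Qed.

End Field.

Lemma alphawV (F : numFieldType) s : alphaw F s^-1 = alphaw F s.
Proof. by rewrite /alphaw /ncycles porbitsV. Qed.

(** Pairing the sum of the antisymmetrisers of f with the conjugate of f gives a
    sum of nonnegative terms, because an antisymmetriser is self-adjoint and a
    positive multiple of its square. *)
Lemma antisym_alpha_eq0 (C : numClosedFieldType) m
    (f : {ffun 'I_n -> 'I_m} -> C) (c : {ffun 'I_n -> 'I_k}) h :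
  (0 < k)%N -> (forall h, alpha_op f h = 0) -> antisym c f h = 0.
Proof.
move=> k0 f0.
pose q (c : {ffun 'I_n -> 'I_k}) := \sum_h antisym c f h * (f h)^*.
have qE c' : q c' = #|young c'|%:R^-1 * \sum_h `|antisym c' f h| ^+ 2.
  have yc0 : #|young c'|%:R != 0 :> C by rewrite pnatr_eq0 -lt0n cardG_gt0.
  apply: (mulfI yc0); rewrite mulVKf // mulr_sumr.
  under eq_bigr do rewrite mulrA -antisym_idem.
  rewrite antisym_dot; apply: eq_bigr => h' _; rewrite normCK; congr (_ * _).
  by rewrite rmorph_sum; apply: eq_bigr => s _; rewrite rmorphM rmorph_sign.
have q_ge0 c' : 0 <= q c'.
  by rewrite qE mulr_ge0 ?invr_ge0 ?ler0n ?sumr_ge0 // => h' _; rewrite exprn_ge0.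
have : \sum_c q c = 0.
  rewrite exchange_big big1 //= => h' _.
  by rewrite -mulr_suml -alpha_opE // f0 mulr0 mul0r.
move/eqP; rewrite psumr_eq0 // => /allP/(_ c); rewrite mem_index_enum => /(_ isT).
rewrite /= qE mulf_eq0 invr_eq0 pnatr_eq0 -leqn0 leqNgt cardG_gt0 /=.
rewrite psumr_eq0 => [/allP/(_ h)|h' _]; last exact: exprn_ge0.
by rewrite mem_index_enum => /(_ isT); rewrite /= sqrf_eq0 normr_eq0 => /eqP.
Qed.

(** By duality, from [symfree_dot] and [antisym_alpha_eq0]. *)
Lemma symfree_alpha (C : numClosedFieldType) m (f : {ffun 'I_n -> 'I_m} -> C) :
  (0 < k)%N -> symfree k f -> exists g, forall h, f h = alpha_op g h.
Proof.
move=> k0 symf.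
pose K (h g : {ffun 'I_n -> 'I_m}) : C := \sum_(s | wperm h s == g) alphaw C s.
have KE v h : \sum_g K h g * v g = alpha_op v h.
  under eq_bigr do rewrite mulr_suml.
  rewrite (exchange_big_dep predT) //=; apply: eq_bigr => s _.
  by rewrite (big_pred1 (wperm h s)) // => g; rewrite eq_sym.
have [|u fE] := @fredholm _ _ K f.
  move=> v v0; apply: (symfree_dot symf) => c h.
  by apply: antisym_alpha_eq0 => // h'; rewrite -KE.
exists u => g; rewrite fE -KE; apply: eq_bigr => h _; rewrite mulrC; congr (_ * _).
rewrite /K (reindex_inj invg_inj) /=.
by apply: eq_big => [s|s _]; rewrite ?alphawV // eq_wperm_inv invgK eq_sym.
Qed.

End AlphaOperator.

(** * Multilinear polynomials and the action of gl_n *)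

Section MultilinearPolynomials.
Variables (F : numFieldType) (n : nat).
Local Notation word := {ffun 'I_n -> 'I_n}.
Local Notation pol := (polmx F n).
Local Notation X := (coordmx F n).
Implicit Types (h : word) (s : 'S_n) (c : word -> F) (f : pol).

Definition wordX h : pol := \prod_(j < n) X (h j) j.

Definition mlpol c : pol := \sum_h c h *: wordX h.

Definition colperm s f : pol := substmx f (col_perm s X).

Fact colperm_is_linear s : linear (colperm s).
Proof. by move=> a f g; rewrite /colperm /substmx linearP. Qed.
HB.instance Definition _ s :=
  GRing.isLinear.Build F pol pol _ (colperm s) (colperm_is_linear s).

Lemma colperm_wordX s h : colperm s (wordX h) = wordX (wperm h s^-1).
Proof.
rewrite /colperm /substmx /wordX rmorph_prod [RHS](reindex_perm s) /=.
apply: eq_bigr => j _; rewrite ffunE permK.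
by rewrite [in LHS]mxE comp_mpolyXU -tnth_nth tnth_mktuple mxvecE mxE.
Qed.

Lemma colperm_mlpol s c : colperm s (mlpol c) = mlpol (fun h => c (wperm h s)).
Proof.
rewrite linear_sum /= /mlpol -[LHS](sum_wperm _ s).
by apply: eq_bigr => h _; rewrite linearZ /= colperm_wordX wpermK.
Qed.

(** Evaluation at the 0-1 matrix with ones at the entries (h j, j) kills the
    monomial of every word except h. *)
Lemma mlpol_inj c : mlpol c = 0 -> forall h, c h = 0.
Proof.
move=> c0 h.
pose v (r : 'I_(n * n)) : F := mxvec (\matrix_(i, j) (h j == i)%:R) 0 r.
have vX g : (wordX g).@[v] = (h == g)%:R.
  rewrite rmorph_prod /=.
  under eq_bigr do rewrite mxE mevalXU /v mxvecE mxE.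
  have [<-|ne] := eqVneq h g; first by rewrite big1 // => j _; rewrite eqxx.
  have [j nej _] := first_diff ne.
  by rewrite (bigD1 j) //= (negbTE nej) mul0r.
have := congr1 (meval v) c0; rewrite raddf_sum meval0 (bigD1 h) //= => <-.
rewrite mevalZ vX eqxx mulr1 big1 ?addr0 // => g ne.
by rewrite mevalZ vX eq_sym (negbTE ne) mulr0.
Qed.

Lemma ALspaceE k f :
  ALspace k f <-> exists2 c, symfree k c & f = mlpol c.
Proof.
have sumE c I : \sum_(s : 'S_n | perm_on I s) colperm s (mlpol c)
    = mlpol (fun h => \sum_(s : 'S_n | perm_on I s) c (wperm h s)).
  under eq_bigr do rewrite colperm_mlpol.
  by rewrite exchange_big; apply: eq_bigr => h _; rewrite scaler_suml.
split=> [[[c ->] symc]|[c symc ->]].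
  by exists c => // I ltkI; apply: mlpol_inj; rewrite -sumE; apply: symc.
split; first by exists c.
move=> I ltkI; have := sumE c I; rewrite /colperm => ->.
by rewrite /mlpol big1 // => h _; rewrite symc // scale0r.
Qed.

Definition wset h (l i : 'I_n) : word := [ffun j => if j == l then i else h j].

Lemma wset_wperm h s l i : wset (wperm h s) l i = wperm (wset h (s l) i) s.
Proof. by apply/ffunP => j; rewrite !ffunE (inj_eq perm_inj). Qed.

(** The matrix unit E_ij replaces one letter j by i, in all possible ways. *)
Lemma glE_wordX i j h : glE i j (wordX h) = \sum_(l | h l == j) wordX (wset h l i).
Proof.
rewrite [RHS]big_mkcond /glE; apply: eq_bigr => l _.
rewrite /wordX (bigD1 l) //= /dcoord mderivM.
rewrite [X in _ * (_ + _ * X)](_ : _ = 0); last first.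
  elim/big_ind: _ => [|p q p0 q0|r rl]; first by rewrite mderivC.
    by rewrite mderivM p0 q0 mulr0 mul0r addr0.
  by apply: etrans (dcoordX _ _ _ _ _) _; rewrite xpair_eqE (negbTE rl) andbF.
rewrite mulr0 addr0 -/(dcoord _ _ _) dcoordX xpair_eqE eqxx andbT.
case: eqP => _; last by rewrite mul0r mulr0.
rewrite mul1r [RHS](bigD1 l) //= ffunE eqxx; congr (_ * _).
by apply: eq_bigr => r rl; rewrite ffunE (negbTE rl).
Qed.

Lemma glE_colperm i j s c :
  glE i j (colperm s (mlpol c)) = colperm s (glE i j (mlpol c)).
Proof.
rewrite (linear_sum (colperm s)) !(linear_sum (glE i j)) (linear_sum (colperm s)).
apply: eq_bigr => h _; rewrite !linearZ /=; congr (_ *: _).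
rewrite colperm_wordX !glE_wordX linear_sum /= (reindex_perm s) /=.
apply: eq_big => [l|l _]; first by rewrite ffunE permK.
by rewrite colperm_wordX wset_wperm permK.
Qed.

Lemma ALspace0 k : ALspace k (0 : pol).
Proof.
apply/ALspaceE; exists (fun=> 0) => [I _ h|]; first by rewrite big1.
by rewrite /mlpol big1 // => h _; rewrite scale0r.
Qed.

Lemma ALspaceP k a f g : ALspace k f -> ALspace k g -> ALspace k (a *: f + g).
Proof.
move=> /ALspaceE[c symc ->] /ALspaceE[d symd ->]; apply/ALspaceE.
exists (fun h => a * c h + d h) => [I ltkI h|].
  by rewrite big_split /= -mulr_sumr symc // symd // mulr0 addr0.
rewrite /mlpol scaler_sumr -big_split; apply: eq_bigr => h _ /=.
by rewrite scalerDl scalerA.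
Qed.

Lemma ALspace_glE k i j f : ALspace k f -> ALspace k (glE i j f).
Proof.
move=> [[c ->] symc]; split; rewrite -/(mlpol c).
  exists (fun g => \sum_(h : word) \sum_(l | (h l == j) && (wset h l i == g)) c h).
  rewrite linear_sum /=; under [RHS]eq_bigr do rewrite scaler_suml.
  rewrite [RHS]exchange_big /=; apply: eq_bigr => h _.
  rewrite linearZ /= glE_wordX scaler_sumr.
  under [RHS]eq_bigr do rewrite scaler_suml.
  rewrite (exchange_big_dep (fun l => h l == j)) /= => [|g l _ /andP[]//].
  by apply: eq_bigr => l hl; rewrite (big_pred1 (wset h l i)) // => g;
    rewrite hl eq_sym.
move=> I ltkI; have /(congr1 (glE i j)) := symc I ltkI.
rewrite linear0 linear_sum => E; rewrite -[RHS]E; apply: eq_bigr => s _ /=.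
exact: esym (glE_colperm i j s c).
Qed.

Section AlphaDeterminants.
Variable k : nat.

(** The alpha-determinant of the matrix with rows h(1), ..., h(n) of X. *)
Definition alphadet h : pol := \sum_s alphaw k F s *: wordX (wperm h s).

Lemma detkE : detk k X = alphadet [ffun j => j].
Proof.
apply: eq_bigr => s _; congr (_ *: _).
by apply: eq_bigr => j _; rewrite !ffunE.
Qed.

(** The alpha-operator acts on coefficients; on the basis of words it yields
    alpha-determinants, since [alphaw] is invariant under inversion. *)
Lemma mlpol_alpha_op c : mlpol (alpha_op k c) = \sum_h c h *: alphadet h.
Proof.
rewrite /mlpol; under eq_bigr do rewrite scaler_suml.
under [RHS]eq_bigr do rewrite scaler_sumr.
rewrite exchange_big [RHS]exchange_big (reindex_inj invg_inj) /=.
apply: eq_bigr => s _; rewrite -[LHS](sum_wperm _ s); apply: eq_bigr => h _.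
by rewrite wpermK alphawV scalerA mulrC.
Qed.

Lemma symfree_alpha_op c : (0 < k)%N -> symfree k (alpha_op k c).
Proof.
move=> k0 I ltkI h.
have kn0 : k%:R ^+ n != 0 :> F by rewrite expf_neq0 // pnatr_eq0 -lt0n.
apply: (mulfI kn0); rewrite mulr0 mulr_sumr.
under eq_bigr do rewrite alpha_opE //.
by rewrite exchange_big big1 //= => col _; apply: symfree_antisym.
Qed.

Lemma ALspace_detk : (0 < k)%N -> ALspace k (detk k X).
Proof.
move=> k0; apply/ALspaceE.
exists (alpha_op k (fun h => (h == [ffun j => j])%:R)).
  exact: symfree_alpha_op.
rewrite mlpol_alpha_op (bigD1 [ffun j => j]) //= eqxx scale1r big1 ?addr0 ?detkE //.
by move=> h /negbTE->; rewrite scale0r.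
Qed.

Lemma glE_alphadet i j h :
  glE i j (alphadet h) = \sum_(l | h l == j) alphadet (wset h l i).
Proof.
rewrite (linear_sum (glE i j)) [RHS]exchange_big /=; apply: eq_bigr => s _.
rewrite linearZ /= glE_wordX -scaler_sumr [in RHS](reindex_perm s) /=.
congr (_ *: _); apply: eq_big => [l|l _]; first by rewrite ffunE.
by rewrite wset_wperm.
Qed.

Lemma glE_alphadet1 i j h l : h l = j -> (forall r, h r = j -> r = l) ->
  glE i j (alphadet h) = alphadet (wset h l i).
Proof.
move=> hl uniql; rewrite glE_alphadet (big_pred1 l) // => r.
by apply/eqP/eqP => [/uniql|->].
Qed.

Section Reach.
Variable N : pol -> Prop.
Hypothesis N_B : forall f g, N f -> N g -> N (f - g).
Hypothesis N_glE : forall i j f, N f -> N (glE i j f).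
Hypothesis N_detk : N (detk k X).

(** When the letters a and b each occur once, E_ba turns a into b, and then E_ab
    turns one of the two letters b into a: this gives back the word, and the
    word with a and b exchanged. *)
Lemma alphadet_tperm s a b : a != b ->
  alphadet [ffun j => tperm a b (s j)]
    = glE a b (glE b a (alphadet [ffun j => s j])) - alphadet [ffun j => s j].
Proof.
move=> ab; pose l := s^-1%g a; pose r := s^-1%g b.
have ne : r != l by rewrite (inj_eq perm_inj) eq_sym.
rewrite (@glE_alphadet1 _ _ _ l) ?ffunE ?permKV // => [|q]; last first.
  by rewrite ffunE /l => <-; rewrite permK.
rewrite glE_alphadet (bigD1 l) /= ?ffunE ?eqxx //.
rewrite (big_pred1 r) => [|q]; last first.
  rewrite !ffunE; case: (eqVneq q l) => [->|ql] /=.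
    by rewrite andbF eq_sym (negbTE ne).
  by rewrite andbT -[b](permKV s) (inj_eq perm_inj).
rewrite [X in alphadet X + _](_ : _ = [ffun j => s j]).
  rewrite addrAC subrr add0r; congr alphadet; apply/ffunP => j; rewrite !ffunE.
  have [->|jr] := eqVneq j r; first by rewrite permKV tpermR.
  have [->|jl] := eqVneq j l; first by rewrite permKV tpermL.
  by rewrite tpermD // eq_sym -[X in _ != X](permKV s) (inj_eq perm_inj).
apply/ffunP => j; rewrite !ffunE.
by have [->|] := eqVneq j l; rewrite ?permKV.
Qed.

Lemma reach_perm s : N (alphadet [ffun j => s j]).
Proof.
have [ts ->] := prod_tpermP s; elim/last_ind: ts => [_|ts [a b] IHts].
  have := N_detk; rewrite detkE big_nil.
  by congr (N (alphadet _)); apply/ffunP => j; rewrite !ffunE perm1.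
rewrite all_rcons => /andP[ab /IHts Nts].
rewrite -cats1 big_cat big_seq1 /=; set t := (\prod_(_ <- _) _)%g in Nts *.
have -> : [ffun j => (t * tperm a b)%g j] = [ffun j => tperm a b (t j)].
  by apply/ffunP => j; rewrite !ffunE permM.
by rewrite alphadet_tperm //; apply: N_B => //; do 2!apply: N_glE.
Qed.

(** Downward induction on the number of distinct letters.  If the letter of h at
    position l also occurs elsewhere, put at l a letter b that h does not use: the
    new word has one more letter, and E_(h l) b leads back to h because b occurs
    only at l. *)
Lemma reach_alphadet h : N (alphadet h).
Proof.
have [p] := ubnP (n - #|h @: 'I_n|); elim: p => // p IHp in h *.
have [/injectiveP injh _|/injectivePn[l [r lr hlr]] ltp] := boolP (injectiveb h).
  have -> : h = [ffun j => perm injh j] by apply/ffunP => j; rewrite ffunE permE.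
  exact: reach_perm.
have ltn : (#|h @: 'I_n| < n)%N.
  rewrite -[X in (_ < X)%N]card_ord ltn_neqAle leq_imset_card andbT.
  apply: contra lr => /imset_injP inj_h; apply/eqP.
  by apply: inj_h.
have [b bh] : exists b, b \notin h @: 'I_n.
  apply/existsP; rewrite -negb_forall; apply: contraTN ltn => /forallP all_h.
  rewrite -leqNgt -[X in (X <= _)%N]card_ord; apply/subset_leq_card/fintype.subsetP.
  by move=> x _.
have hb q : h q != b by apply: contraNneq bh => <-; exact: imset_f.
have -> : h = wset (wset h l b) l (h l).
  by apply/ffunP => j; rewrite !ffunE; have [->|] := eqVneq j l.
rewrite -(@glE_alphadet1 _ b) ?ffunE ?eqxx // => [|q]; last first.
  by rewrite ffunE; have [->//|_ /eqP] := eqVneq q l; rewrite (negbTE (hb q)).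
apply/N_glE/IHp.
suff : (#|b |: h @: 'I_n| <= #|wset h l b @: 'I_n|)%N by rewrite cardsU1 bh; lia.
apply/subset_leq_card/fintype.subsetP => x /setU1P[->|/imsetP[q _ ->]].
  by apply/imsetP; exists l; rewrite // ffunE eqxx.
apply/imsetP; have [->|ql] := eqVneq q l.
  by exists r; rewrite // ffunE eq_sym (negbTE lr).
by exists q; rewrite // ffunE (negbTE ql).
Qed.

End Reach.
End AlphaDeterminants.
End MultilinearPolynomials.

Section CyclicSubmodule.
Variables (F : fieldType) (n : nat).
Implicit Types d f g : polmx F n.

Lemma cyclic_gen d : Ugl_cyclic d d.
Proof. by exists 1; rewrite ?Uglact1. Qed.

Lemma cyclicP d a f g :
  Ugl_cyclic d f -> Ugl_cyclic d g -> Ugl_cyclic d (a *: f + g).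
Proof.
move=> [u _ <-] [v _ <-].
by exists (a *: u + v); rewrite ?Uglact_linearl.
Qed.

Lemma cyclic_glE d i j f : Ugl_cyclic d f -> Ugl_cyclic d (glE i j f).
Proof. by move=> [u _ <-]; exists (UglE F i j * u); rewrite ?UglactM ?UglactE. Qed.

(** Elements of the enveloping algebra act as linear combinations of products
    of matrix units. *)
Lemma cyclic_min d (N : polmx F n -> Prop) :
    N 0 -> (forall a f g, N f -> N g -> N (a *: f + g)) ->
    (forall i j f, N f -> N (glE i j f)) -> N d ->
  forall f, Ugl_cyclic d f -> N f.
Proof.
move=> N0 NP NglE Nd f [u _ <-]; rewrite /Uglact /tensact.
elim/big_rec: _ => // w g _; apply: NP; rewrite /wordact.
by elim: (monalg.fmonom_val w) => //= a s; apply: NglE.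
Qed.

End CyclicSubmodule.

Theorem theorem3p1 (R : realType) (n k : nat) (hk : (1 <= k <= n - 1)%N) :
  @ALspace R[i] n k = @Ugl_cyclic R[i] n (detk k (coordmx R[i] n)).
Proof.
have /andP[k0 _] := hk; apply/seteqP; split=> f.
  case/ALspaceE => c /(symfree_alpha k0)[g cE] ->.
  have -> : mlpol c = \sum_h g h *: alphadet _ k h.
    by rewrite -mlpol_alpha_op; apply: eq_bigr => h _; rewrite cE.
  have cyclic0 : Ugl_cyclic (detk k (coordmx R[i] n)) 0.
    have := cyclicP (-1) (cyclic_gen _) (cyclic_gen (detk k (coordmx R[i] n))).
    by rewrite scaleN1r addNr.
  elim/big_rec: _ => // h p _; apply: cyclicP.
  apply: reach_alphadet (cyclic_gen _) _ => [p1 p2 N1 N2|].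
    by rewrite addrC -scaleN1r; apply: cyclicP.
  exact: cyclic_glE.
apply: cyclic_min; [exact: ALspace0|exact: ALspaceP|exact: ALspace_glE|].
exact: ALspace_detk.
Qed.
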